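(* Let $\alpha_1,\beta_1,\alpha_2,\beta_2$ be real numbers. The double inequalities $$A^{\alpha_{1}}(a,b)\,G^{1-\alpha_{1}}(a,b)<N_{GA}(a,b)<A^{\beta_{1}}(a,b)\,G^{1-\beta_{1}}(a,b),$$ $$\frac{\alpha_{2}}{G(a,b)}+\frac{1-\alpha_{2}}{A(a,b)}<\frac{1}{N_{GA}(a,b)}<\frac{\beta_{2}}{G(a,b)}+\frac{1-\beta_{2}}{A(a,b)}$$ hold for all $a,b>0$ with $a\neq b$ if and only if $\alpha_{1}\leq 2/3$, $\beta_{1}\geq 1$, $\alpha_{2}\leq 0$ and $\beta_{2}\geq 1/3$.
   Context: For $a,b>0$, $G(a,b)=\sqrt{ab}$ and $A(a,b)=(a+b)/2$ are the geometric and arithmetic means; $A^{p}(a,b)$ means $(A(a,b))^{p}$, and similarly for $G$. For $a,b>0$ with $a\ne b$, the Schwab-Borchardt mean is $$SB(a,b)=\begin{cases}\dfrac{\sqrt{b^2-a^2}}{\cos^{-1}(a/b)}, & a<b,\\[2mm] \dfrac{\sqrt{a^2-b^2}}{\cosh^{-1}(a/b)}, & a>b,\end{cases}$$ where $\cos^{-1}$ is the inverse cosine and $\cosh^{-1}(x)=\log(x+\sqrt{x^2-1})$ is the inverse hyperbolic cosine. The Neuman mean is $N(a,b)=\frac12\left(a+\frac{b^{2}}{SB(a,b)}\right)$, and $N_{GA}(a,b)=N(G(a,b),A(a,b))$ for $a\neq b$. *)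

(* Defs.v *)
From Stdlib Require Import Reals.
Open Scope R_scope.

Definition arcosh (x : R) : R := ln (x + sqrt (x ^ 2 - 1)).

Definition gmean (a b : R) : R := sqrt (a * b).

Definition amean (a b : R) : R := (a + b) / 2.

(* Meaningful only for a, b > 0 with a <> b; the value at a = b is junk. *)
Definition SB (a b : R) : R :=
  if Rlt_dec a b then sqrt (b ^ 2 - a ^ 2) / acos (a / b)
  else sqrt (a ^ 2 - b ^ 2) / arcosh (a / b).

Definition neuman (a b : R) : R := / 2 * (a + b ^ 2 / SB a b).

Definition neuman_GA (a b : R) : R := neuman (gmean a b) (amean a b).

(* Main.v *)
Require Import Defs.
From Stdlib Require Import Reals Lra.
From Coquelicot Require Import Coquelicot.
Open Scope R_scope.

(** All the quantities compared are homogeneous of degree 1 or -1 and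
    G(a,b) < A(a,b), so everything depends on the single angle t in ]0, PI/2[
    with G = A cos t; every such t occurs.  As SB(G, A) = A sin t / t, one gets
    N_GA = A nu(t) with nu(t) = (cos t + t / sin t) / 2, and, writing
    c = cos t, the theorem is about
      c^(1-alpha1) < nu < c^(1-beta1)
      and alpha2 / c + 1 - alpha2 < 1 / nu < beta2 / c + 1 - beta2.

    Sufficiency.  Two inequalities carry everything: nu < 1
    ([neuman_angle_lt_1]) and c^(1/3) < nu ([cbrt_cos_lt_neuman_angle]).  After
    multiplication by sin t both say that a function vanishing at 0 is
    positive, and its derivative factors into visibly positive terms.  The
    bounds with other exponents follow because c < 1, and the harmonic bound
    with beta2 = 1/3 follows from c^(1/3) < nu by the geometric-harmonic mean
    inequality 3 / (1/c + 1 + 1) <= c^(1/3).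

    Necessity.  At t -> 0, where 1 - nu ~ t^2/6 and 1/c - 1 ~ t^2/2, an
    inequality 1 - nu < k (1/c - 1) forces k >= 1/3
    ([neuman_angle_slope_at_0]); the lower bound with exponent 1 - alpha1 and
    the upper bound with beta2 both imply such an inequality, with
    k = 1 - alpha1 and k = beta2.  At t -> PI/2 the variable c tends to 0 while
    nu stays above 1/2; this rules out beta1 < 1 and alpha2 > 0, each with an
    explicit value of c. *)

(** * Reduction to one angle *)

(** The value of N(cos t, 1), that is, of N_GA for arithmetic mean 1. *)
Definition neuman_angle (t : R) : R := (cos t + t / sin t) / 2.

Definition normalized_bounds (alpha1 beta1 alpha2 beta2 t : R) : Prop :=
  (Rpower (cos t) (1 - alpha1) < neuman_angle t
     < Rpower (cos t) (1 - beta1)) /\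
  (alpha2 / cos t + (1 - alpha2) < / neuman_angle t
     < beta2 / cos t + (1 - beta2)).

Lemma sin_cos_bounds (t : R) :
  0 < t < PI / 2 -> 0 < sin t < 1 /\ 0 < cos t < 1.
Proof.
intros ht.
assert (hs : 0 < sin t) by (apply sin_gt_0; lra).
assert (hc : 0 < cos t) by (apply cos_gt_0; lra).
pose proof (sin2_cos2 t) as h1; unfold Rsqr in h1.
nra.
Qed.

Lemma acos_angle (c : R) :
  0 < c < 1 -> 0 < acos c < PI / 2 /\ cos (acos c) = c.
Proof.
intros hc.
assert (hcos : cos (acos c) = c) by (apply cos_acos; lra).
destruct (acos_bound c) as [h0 hpi].
repeat split; trivial.
- destruct h0 as [h0 | h0]; trivial.
  rewrite <- h0, cos_0 in hcos; lra.
- apply Rnot_le_lt; intros h.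
  assert (cos (acos c) <= 0) by (apply cos_le_0; lra).
  lra.
Qed.

Lemma neuman_cos (A t : R) :
  0 < A -> 0 < t < PI / 2 -> neuman (A * cos t) A = A * neuman_angle t.
Proof.
intros hA ht.
destruct (sin_cos_bounds t ht) as [hs hc].
unfold neuman, SB, neuman_angle.
destruct (Rlt_dec (A * cos t) A) as [_ | hn]; [| exfalso; apply hn; nra].
replace (A * cos t / A) with (cos t) by (field; lra).
rewrite acos_cos by lra.
replace (sqrt (A ^ 2 - (A * cos t) ^ 2)) with (A * sin t).
- field; lra.
- symmetry; apply sqrt_lem_1.
  + pose proof (sin2_cos2 t) as h1; unfold Rsqr in h1; nra.
  + nra.
  + pose proof (sin2_cos2 t) as h1; unfold Rsqr in h1.
    replace (sin t) with (sin t * 1) by ring.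
    replace (A ^ 2 - (A * cos t) ^ 2) with (A ^ 2 * (1 - cos t * cos t)) by ring.
    replace (1 - cos t * cos t) with (sin t * sin t) by lra.
    ring.
Qed.

Lemma neuman_angle_pos (t : R) : 0 < t < PI / 2 -> / 2 < neuman_angle t.
Proof.
intros ht.
destruct (sin_cos_bounds t ht) as [hs hc].
unfold neuman_angle.
assert (1 < t / sin t); [| lra].
apply (Rmult_lt_reg_r (sin t)); [lra |].
pose proof (sin_lt_x t (proj1 ht)).
replace (t / sin t * sin t) with t by (field; lra); lra.
Qed.

Lemma bounds_homogeneous (alpha1 beta1 alpha2 beta2 A t : R) :
  0 < A -> 0 < t < PI / 2 ->
  (Rpower A alpha1 * Rpower (A * cos t) (1 - alpha1) < neuman (A * cos t) A
     < Rpower A beta1 * Rpower (A * cos t) (1 - beta1)) /\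
  (alpha2 / (A * cos t) + (1 - alpha2) / A < 1 / neuman (A * cos t) A
     < beta2 / (A * cos t) + (1 - beta2) / A)
  <-> normalized_bounds alpha1 beta1 alpha2 beta2 t.
Proof.
intros hA ht.
destruct (sin_cos_bounds t ht) as [hs hc].
pose proof (neuman_angle_pos t ht) as hn.
assert (hpow : forall p, Rpower A p * Rpower (A * cos t) (1 - p)
                         = A * Rpower (cos t) (1 - p)).
{ intros p.
  rewrite <- Rpower_mult_distr, <- Rmult_assoc, <- Rpower_plus by lra.
  replace (p + (1 - p)) with 1 by ring.
  now rewrite Rpower_1. }
assert (hdiv : forall p, p / (A * cos t) + (1 - p) / A
                         = / A * (p / cos t + (1 - p))).
{ intros p; field; lra. }
rewrite !hpow, !hdiv, (neuman_cos A t hA ht).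
replace (1 / (A * neuman_angle t)) with (/ A * / neuman_angle t)
  by (field; lra).
assert (hscale : forall k x y, 0 < k -> (k * x < k * y <-> x < y)).
{ intros k x y hk; split; intros h.
  - now apply (Rmult_lt_reg_l k).
  - now apply Rmult_lt_compat_l. }
assert (hA' : 0 < / A) by now apply Rinv_0_lt_compat.
unfold normalized_bounds.
now rewrite !hscale.
Qed.

Lemma gmean_lt_amean (a b : R) :
  0 < a -> 0 < b -> a <> b -> 0 < gmean a b < amean a b.
Proof.
intros ha hb hab.
unfold gmean, amean.
assert (hp : 0 < a * b) by nra.
split; [now apply sqrt_lt_R0 |].
rewrite <- (sqrt_Rsqr ((a + b) / 2)) by lra.
apply sqrt_lt_1_alt; unfold Rsqr.
assert (0 < (a - b) ^ 2) by (apply pow2_gt_0; lra).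
lra.
Qed.

Lemma bounds_iff_normalized (alpha1 beta1 alpha2 beta2 : R) :
  (forall a b : R, 0 < a -> 0 < b -> a <> b ->
     (Rpower (amean a b) alpha1 * Rpower (gmean a b) (1 - alpha1)
        < neuman_GA a b
        < Rpower (amean a b) beta1 * Rpower (gmean a b) (1 - beta1)) /\
     (alpha2 / gmean a b + (1 - alpha2) / amean a b
        < 1 / neuman_GA a b
        < beta2 / gmean a b + (1 - beta2) / amean a b))
  <->
  (forall t, 0 < t < PI / 2 -> normalized_bounds alpha1 beta1 alpha2 beta2 t).
Proof.
split.
- intros H t ht.
  destruct (sin_cos_bounds t ht) as [hs hc].
  (* These arguments have arithmetic mean 1 and geometric mean cos t. *)
  specialize (H (1 + sin t) (1 - sin t) ltac:(lra) ltac:(lra) ltac:(lra)).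
  unfold neuman_GA in H.
  replace (amean (1 + sin t) (1 - sin t)) with 1 in H
    by (unfold amean; field).
  replace (gmean (1 + sin t) (1 - sin t)) with (1 * cos t) in H.
  + now apply (bounds_homogeneous _ _ _ _ 1 t Rlt_0_1 ht).
  + unfold gmean; symmetry; apply sqrt_lem_1; try nra.
    pose proof (sin2_cos2 t) as h1; unfold Rsqr in h1; nra.
- intros H a b ha hb hab.
  destruct (gmean_lt_amean a b ha hb hab) as [hG hGA].
  unfold neuman_GA.
  set (G := gmean a b) in *; set (A := amean a b) in *.
  destruct (acos_angle (G / A)) as [ht hcos].
  { split; [apply Rdiv_lt_0_compat; lra |].
    apply (Rmult_lt_reg_r A); [lra |].
    replace (G / A * A) with G by (field; lra); lra. }
  replace G with (A * cos (acos (G / A))) by (rewrite hcos; field; lra).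
  apply bounds_homogeneous; [lra | exact ht |].
  now apply H.
Qed.

(** * The two sharp inequalities *)

Lemma pos_of_derive_pos (f f' : R -> R) (t : R) :
  0 < t -> f 0 = 0 ->
  (forall x, 0 <= x <= t -> is_derive f x (f' x)) ->
  (forall x, 0 < x < t -> 0 < f' x) -> 0 < f t.
Proof.
intros ht f0 hd hpos.
destruct (MVT_cor2 f f' 0 t ht) as [x [hx hxt]].
- intros x hx; now apply is_derive_Reals, hd.
- specialize (hpos x hxt); nra.
Qed.

(** The function (2 - cos t) sin t - t has derivative 2 cos t (1 - cos t). *)
Lemma neuman_angle_lt_1 (t : R) : 0 < t < PI / 2 -> neuman_angle t < 1.
Proof.
intros ht.
destruct (sin_cos_bounds t ht) as [hs hc].
assert (h : 0 < (2 - cos t) * sin t - t).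
{ apply (pos_of_derive_pos (fun x => (2 - cos x) * sin x - x)
           (fun x => 2 * cos x * (1 - cos x))); try lra.
  - rewrite sin_0; ring.
  - intros x hx; auto_derive; trivial.
    pose proof (sin2_cos2 x) as h1; unfold Rsqr in h1; lra.
  - intros x hx.
    destruct (sin_cos_bounds x ltac:(lra)) as [_ hcx]; nra. }
unfold neuman_angle.
assert (t / sin t < 2 - cos t); [| lra].
apply (Rmult_lt_reg_r (sin t)); [lra |].
replace (t / sin t * sin t) with t by (field; lra); lra.
Qed.

Lemma Rpower_third_cubed (c : R) : 0 < c -> Rpower c (1 / 3) ^ 3 = c.
Proof.
intros hc.
rewrite <- Rpower_pow by apply exp_pos.
rewrite Rpower_mult.
replace (1 / 3 * INR 3) with 1 by (simpl; field).
now apply Rpower_1.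
Qed.

Lemma Rpower_lt_1 (c p : R) : 0 < c < 1 -> 0 < p -> Rpower c p < 1.
Proof.
intros hc hp.
rewrite <- exp_0.
unfold Rpower; apply exp_increasing.
assert (ln c < 0) by (rewrite <- ln_1; apply ln_increasing; lra).
nra.
Qed.

Lemma Rpower_le_exponent (c p q : R) :
  0 < c < 1 -> p <= q -> Rpower c q <= Rpower c p.
Proof.
intros hc hpq.
destruct hpq as [hpq | ->]; [left | right; reflexivity].
unfold Rpower; apply exp_increasing.
assert (ln c < 0) by (rewrite <- ln_1; apply ln_increasing; lra).
nra.
Qed.

(** With u = (cos t)^(1/3), the function t - (2 u - u^3) sin t has derivative
    2 (1 - 4 u^6 + 3 u^8) / (3 u^2), and in terms of v = u^2
    the polynomial is 1 - 4 v^3 + 3 v^4 = (1 - v)^2 (3 v^2 + 2 v + 1). *)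
Lemma cbrt_cos_lt_neuman_angle (t : R) :
  0 < t < PI / 2 -> Rpower (cos t) (1 / 3) < neuman_angle t.
Proof.
intros ht.
destruct (sin_cos_bounds t ht) as [hs hc].
set (u := fun x => Rpower (cos x) (1 / 3)).
assert (h : 0 < t - (2 * u t - cos t) * sin t).
{ apply (pos_of_derive_pos (fun x => x - (2 * u x - cos x) * sin x)
     (fun x => 2 / (3 * u x ^ 2)
               * ((1 - u x ^ 2) ^ 2 * (3 * u x ^ 4 + 2 * u x ^ 2 + 1)))).
  - lra.
  - rewrite sin_0; ring.
  - intros x hx.
    assert (hcx : 0 < cos x) by (apply cos_gt_0; lra).
    unfold u, Rpower; auto_derive; [lra |].
    change (exp (1 / 3 * ln (cos x))) with (u x).
    assert (hu : 0 < u x) by apply exp_pos.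
    assert (hu3 : u x ^ 3 = cos x) by now apply Rpower_third_cubed.
    pose proof (sin2_cos2 x) as h1; unfold Rsqr in h1.
    assert (hs2 : sin x * sin x = 1 - u x ^ 6).
    { replace (u x ^ 6) with (u x ^ 3 * u x ^ 3) by ring.
      rewrite hu3; lra. }
    assert (hu2 : u x / cos x = / u x ^ 2) by (rewrite <- hu3; field; lra).
    transitivity (1 - (2 * u x - cos x) * cos x
                  + (sin x * sin x) * (2 / 3 * (u x / cos x) - 1));
      [field; lra |].
    rewrite hs2, hu2, <- hu3.
    field; lra.
  - intros x hx.
    destruct (sin_cos_bounds x ltac:(lra)) as [_ hcx].
    assert (hu : 0 < u x) by apply exp_pos.
    assert (hu1 : u x < 1) by (apply Rpower_lt_1; lra).
    assert (0 < 1 - u x ^ 2) by nra.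
    apply Rmult_lt_0_compat.
    + apply Rdiv_lt_0_compat; [lra | nra].
    + apply Rmult_lt_0_compat; [now apply pow_lt |].
      pose proof (pow_lt _ 4 hu); pose proof (pow_lt _ 2 hu); lra. }
unfold neuman_angle; fold (u t).
assert (2 * u t - cos t < t / sin t); [| lra].
apply (Rmult_lt_reg_r (sin t)); [lra |].
replace (t / sin t * sin t) with t by (field; lra); lra.
Qed.

(** This is the geometric-harmonic mean inequality for c, 1, 1; for
    u = c^(1/3) it is (1 - u)^2 (1 + 2 u) >= 0. *)
Lemma inv_Rpower_third_le (c : R) :
  0 < c -> / Rpower c (1 / 3) <= (1 / 3) / c + (1 - 1 / 3).
Proof.
intros hc.
pose proof (Rpower_third_cubed c hc) as h3.
assert (hu : 0 < Rpower c (1 / 3)) by apply exp_pos.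
set (u := Rpower c (1 / 3)) in *.
rewrite <- h3.
assert (h : 0 <= (1 - u) ^ 2 * (1 + 2 * u) / (3 * u ^ 3)).
{ apply Rle_mult_inv_pos.
  - apply Rmult_le_pos; [apply pow2_ge_0 | lra].
  - pose proof (pow_lt _ 3 hu); lra. }
replace ((1 - u) ^ 2 * (1 + 2 * u) / (3 * u ^ 3))
  with ((1 / 3) / u ^ 3 + (1 - 1 / 3) - / u) in h by (field; lra).
lra.
Qed.

Lemma normalized_bounds_sufficient (alpha1 beta1 alpha2 beta2 t : R) :
  alpha1 <= 2 / 3 -> 1 <= beta1 -> alpha2 <= 0 -> 1 / 3 <= beta2 ->
  0 < t < PI / 2 -> normalized_bounds alpha1 beta1 alpha2 beta2 t.
Proof.
intros ha1 hb1 ha2 hb2 ht.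
destruct (sin_cos_bounds t ht) as [_ hc].
pose proof (neuman_angle_pos t ht) as hn0.
pose proof (neuman_angle_lt_1 t ht) as hn1.
pose proof (cbrt_cos_lt_neuman_angle t ht) as hcb.
assert (hic : 1 < / cos t).
{ rewrite <- Rinv_1 at 1; apply Rinv_lt_contravar; lra. }
unfold normalized_bounds, Rdiv at 1 2; repeat split.
- apply Rle_lt_trans with (2 := hcb).
  apply Rpower_le_exponent; lra.
- apply Rlt_le_trans with (1 := hn1).
  pose proof (Rpower_le_exponent (cos t) (1 - beta1) 0 hc ltac:(lra)) as hp.
  now rewrite Rpower_O in hp by lra.
- assert (1 < / neuman_angle t).
  { rewrite <- Rinv_1 at 1; apply Rinv_lt_contravar; lra. }
  nra.
- assert (/ neuman_angle t < / Rpower (cos t) (1 / 3)).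
  { apply Rinv_lt_contravar; trivial.
    apply Rmult_lt_0_compat; [apply exp_pos | lra]. }
  pose proof (inv_Rpower_third_le (cos t) (proj1 hc)) as hi.
  unfold Rdiv in hi at 2; nra.
Qed.

(** * Sharpness *)

Lemma sin_cos_taylor (t : R) :
  0 <= t <= 1 ->
  t - t ^ 3 / 6 <= sin t /\ 1 - t ^ 2 / 2 <= cos t <= 1 - t ^ 2 / 2 + t ^ 4 / 24.
Proof.
intros ht.
destruct (pre_sin_bound t 0 ltac:(lra) ltac:(lra)) as [hs _].
destruct (pre_cos_bound t 0 ltac:(lra) ltac:(lra)) as [hc1 hc2].
unfold sin_approx, cos_approx, sin_term, cos_term in *; simpl in *.
lra.
Qed.

(** As t tends to 0, the two sides are equivalent to t^2/6 and k t^2/2.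
    The Taylor bounds make this quantitative: with x = t^2 they
    yield 1/3 - 3 x / 40 <= k (1 + x), which fails at x = 1/3 - k when
    0 <= k < 1/3. *)
Lemma neuman_angle_slope_at_0 (k : R) :
  (forall t, 0 < t < PI / 2 -> 1 - neuman_angle t < k * (/ cos t - 1)) ->
  1 / 3 <= k.
Proof.
intros H.
apply Rnot_lt_le; intros hk.
pose proof PI2_1 as hpi.
assert (hk0 : 0 <= k).
{ assert (h1 : 0 < 1 < PI / 2) by lra.
  specialize (H 1 h1).
  destruct (sin_cos_bounds 1 h1) as [_ hc].
  pose proof (neuman_angle_lt_1 1 h1).
  assert (1 < / cos 1).
  { rewrite <- Rinv_1 at 1; apply Rinv_lt_contravar; lra. }
  nra. }
set (x := 1 / 3 - k).
assert (hx : 0 < x <= 1 / 3) by (unfold x; lra).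
set (t := sqrt x).
assert (htx : t ^ 2 = x) by (apply pow2_sqrt; lra).
assert (ht0 : 0 < t) by (apply sqrt_lt_R0; lra).
assert (ht1 : t < 1) by nra.
specialize (H t ltac:(lra)).
destruct (sin_cos_taylor t ltac:(lra)) as [hs [hc1 hc2]].
replace (t ^ 4) with (x * x) in hc2 by (rewrite <- htx; ring).
replace (t ^ 3) with (t * x) in hs by (rewrite <- htx; ring).
rewrite htx in *.
destruct (sin_cos_bounds t ltac:(lra)) as [hsb hcb].
(* One has 1 / (1 - x/6) = 1 + x / (6 - x), and 1/6 + x/30 is the chord on
   [0, 1] of the convex function 1 / (6 - x). *)
assert (hts : t / sin t <= 1 + x * (1 / 6 + x / 30)).
{ apply (Rmult_le_reg_r (sin t)); [lra |].
  replace (t / sin t * sin t) with t by (field; lra).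
  assert (1 <= (1 + x * (1 / 6 + x / 30)) * (1 - x / 6)) by nra.
  apply Rle_trans with ((1 + x * (1 / 6 + x / 30)) * (t * (1 - x / 6))).
  - nra.
  - apply Rmult_le_compat_l; nra. }
assert (hic : / cos t <= 1 + x / 2 * (1 + x)).
{ apply (Rmult_le_reg_r (cos t)); [lra |].
  rewrite Rinv_l by lra.
  apply Rle_trans with ((1 + x / 2 * (1 + x)) * (1 - x / 2)).
  - nra.
  - apply Rmult_le_compat_l; nra. }
unfold neuman_angle in H.
assert (hkx : k * (/ cos t - 1) <= k * (x / 2 * (1 + x)))
  by (apply Rmult_le_compat_l; lra).
assert (hmain : x / 2 * (1 / 3 - 3 / 40 * x) < x / 2 * (k * (1 + x))) by nra.
apply Rmult_lt_reg_l in hmain; [| lra].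
replace k with (1 / 3 - x) in hmain by (unfold x; ring).
nra.
Qed.

(** The factor k >= 0 makes the tangent-line bounds c^k >= 1 + k ln c
    and ln c >= 1 - 1/c combine in the same direction. *)
Lemma one_sub_Rpower_le (c k : R) :
  0 < c -> 0 <= k -> 1 - Rpower c k <= k * (/ c - 1).
Proof.
intros hc hk.
pose proof (exp_ineq1_le (k * ln c)) as h1.
pose proof (exp_ineq1_le (- ln c)) as h2.
rewrite exp_Ropp, exp_ln in h2 by assumption.
unfold Rpower; nra.
Qed.

Lemma normalized_bounds_necessary (alpha1 beta1 alpha2 beta2 : R) :
  (forall t, 0 < t < PI / 2 -> normalized_bounds alpha1 beta1 alpha2 beta2 t) ->
  alpha1 <= 2 / 3 /\ 1 <= beta1 /\ alpha2 <= 0 /\ 1 / 3 <= beta2.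
Proof.
intros H.
repeat split.
- assert (hk : 0 <= 1 - alpha1).
  { apply Rnot_lt_le; intros hlt.
    pose proof PI2_1 as hpi.
    assert (h1 : 0 < 1 < PI / 2) by lra.
    destruct (H 1 h1) as [[h _] _].
    destruct (sin_cos_bounds 1 h1) as [_ hc].
    pose proof (neuman_angle_lt_1 1 h1).
    pose proof (Rpower_le_exponent (cos 1) (1 - alpha1) 0 hc ltac:(lra)) as hp.
    rewrite Rpower_O in hp by lra; lra. }
  assert (1 / 3 <= 1 - alpha1); [| lra].
  apply neuman_angle_slope_at_0; intros t ht.
  destruct (H t ht) as [[h _] _].
  destruct (sin_cos_bounds t ht) as [_ hc].
  pose proof (one_sub_Rpower_le (cos t) (1 - alpha1) (proj1 hc) hk); lra.
- apply Rnot_lt_le; intros hlt.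
  (* For this c the bound c^(1 - beta1) equals 1/2. *)
  set (c := Rpower (/ 2) (/ (1 - beta1))).
  assert (hc : 0 < c < 1).
  { split; [apply exp_pos |].
    apply Rpower_lt_1; [lra |]. apply Rinv_0_lt_compat; lra. }
  destruct (acos_angle c hc) as [ht hcos].
  destruct (H _ ht) as [[_ h] _].
  pose proof (neuman_angle_pos _ ht) as hn.
  rewrite hcos in h; unfold c at 2 in h.
  rewrite Rpower_mult, Rinv_l, Rpower_1 in h by lra.
  lra.
- apply Rnot_lt_le; intros hlt.
  (* For this c the lower bound alpha2 / c + 1 - alpha2 equals 2. *)
  set (c := alpha2 / (1 + alpha2)).
  assert (hc : 0 < c < 1).
  { split; [apply Rdiv_lt_0_compat; lra |].
    apply (Rmult_lt_reg_r (1 + alpha2)); [lra |].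
    unfold c; replace (alpha2 / (1 + alpha2) * (1 + alpha2)) with alpha2
      by (field; lra); lra. }
  destruct (acos_angle c hc) as [ht hcos].
  destruct (H _ ht) as [_ [h _]].
  pose proof (neuman_angle_pos _ ht) as hn.
  assert (hi : / neuman_angle (acos c) < / / 2)
    by (apply Rinv_lt_contravar; lra).
  rewrite Rinv_inv in hi.
  rewrite hcos in h.
  replace (alpha2 / c + (1 - alpha2)) with 2 in h
    by (unfold c; field; lra).
  lra.
- apply neuman_angle_slope_at_0; intros t ht.
  destruct (H t ht) as [_ [_ h]].
  destruct (sin_cos_bounds t ht) as [_ hc].
  pose proof (neuman_angle_pos t ht) as hn.
  set (n := neuman_angle t) in *.
  (* Here 1 - n <= 1/n - 1, since n + 1/n >= 2. *)
  assert (hi : 0 <= (1 - n) ^ 2 / n)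
    by (apply Rle_mult_inv_pos; [apply pow2_ge_0 | lra]).
  replace ((1 - n) ^ 2 / n) with (/ n - 1 - (1 - n)) in hi by (field; lra).
  unfold Rdiv in h; lra.
Qed.

Theorem theorem3p1 (alpha1 beta1 alpha2 beta2 : R) :
  (forall a b : R, 0 < a -> 0 < b -> a <> b ->
     (Rpower (amean a b) alpha1 * Rpower (gmean a b) (1 - alpha1)
        < neuman_GA a b
        < Rpower (amean a b) beta1 * Rpower (gmean a b) (1 - beta1)) /\
     (alpha2 / gmean a b + (1 - alpha2) / amean a b
        < 1 / neuman_GA a b
        < beta2 / gmean a b + (1 - beta2) / amean a b))
  <->
  (alpha1 <= 2 / 3 /\ 1 <= beta1 /\ alpha2 <= 0 /\ 1 / 3 <= beta2).
Proof.
rewrite bounds_iff_normalized.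
split.
- apply normalized_bounds_necessary.
- intros [ha1 [hb1 [ha2 hb2]]] t ht.
  now apply normalized_bounds_sufficient.
Qed.
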